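(* Let $a_1,\ldots,a_n$ be nonzero real scalars. Then the function $f:\mathbb{R}^n\to\mathbb{R}$, $$f(x)=\sum_{i=1}^n x_i^2(x_i-a_i)^2+\sum_{1\le i<j\le n}x_i^2x_j^2,$$ has no spurious minimizers, i.e., every local minimizer of $f$ is also a global minimizer of $f$.
   Context: A spurious minimizer of a function on $\mathbb{R}^n$ is a local minimizer that is not a global minimizer. *)

(* Defs.v *)
From HB Require Import structures.
From mathcomp Require Import all_boot all_order all_algebra.
From mathcomp Require Import all_classical all_reals all_analysis.
Set Implicit Arguments.
Unset Strict Implicit.
Unset Printing Implicit Defensive.
Import Order.TTheory GRing.Theory Num.Theory.
Import numFieldNormedType.Exports.
Local Open Scope classical_set_scope.
Local Open Scope ring_scope.

(* R^n is the space of row vectors 'rV[R]_n with its product topology. *)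

Definition local_minimizer (R : realType) (n : nat) (f : 'rV[R]_n -> R)
    (x : 'rV[R]_n) : Prop :=
  \forall y \near x, f x <= f y.

Definition global_minimizer (R : realType) (n : nat) (f : 'rV[R]_n -> R)
    (x : 'rV[R]_n) : Prop :=
  forall y : 'rV[R]_n, f x <= f y.

Definition spurious_minimizer (R : realType) (n : nat) (f : 'rV[R]_n -> R)
    (x : 'rV[R]_n) : Prop :=
  local_minimizer f x /\ ~ global_minimizer f x.

(* Main.v *)
(** Along a coordinate line, [f] is [z^2 (z - a_i)^2 + c z^2] up to a constant,
    where [c] is the sum of the squares of the other coordinates.  At a local
    minimizer with [x_i != 0] the first derivative vanishes, so
    [c = - (2 x_i - a_i) (x_i - a_i)], and completing the square in [a_i] gives
    [4 c <= x_i^2].  Two nonzero coordinates would thus satisfy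
    [4 x_j^2 <= x_i^2] and [4 x_i^2 <= x_j^2], which is absurd.  With exactly one
    nonzero coordinate, [c = 0] and [x_i] is [a_i] or [a_i / 2]; the latter is
    excluded by the second derivative, so [f x = 0], its least value. *)
Require Import Defs.
From HB Require Import structures.
From mathcomp Require Import all_boot all_order all_algebra.
From mathcomp Require Import all_classical all_reals all_analysis.
From mathcomp Require Import ring lra.
Import Order.TTheory GRing.Theory Num.Theory.
Import numFieldNormedType.Exports.
Local Open Scope classical_set_scope.
Local Open Scope ring_scope.

(** First-order condition: if [q 0] were nonzero, [q] would keep its sign near 0, and a small [t] of
    the opposite sign would make [t * q t] negative. *)
Lemma near0_mul_ge0_eq0 {R : realType} {q : R -> R} :
  {for 0, continuous q} -> (\forall t \near 0, 0 <= t * q t) -> q 0 = 0.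
Proof.
move=> cq H; apply: contrapT => /eqP; rewrite neq_lt => /orP[q0|q0].
- have /nbhs_ballP[e /= e0 He] : \forall t \near 0, q t < 0 /\ 0 <= t * q t
    by apply: filterI H; exact: cq _ (lt_nbhsl q0).
  have [] := He (e / 2); first by rewrite /ball /= sub0r normrN gtr0_norm; lra.
  by rewrite /=; nra.
- have /nbhs_ballP[e /= e0 He] : \forall t \near 0, 0 < q t /\ 0 <= t * q t
    by apply: filterI H; exact: cq _ (lt_nbhsr q0).
  have [] := He (- (e / 2)); first by rewrite /ball /= sub0r opprK gtr0_norm; lra.
  by rewrite /=; nra.
Qed.

(** Second-order condition, used once the linear term of an increment vanishes. *)
Lemma near0_mul_sqr_ge0 {R : realType} {q : R -> R} :
  {for 0, continuous q} -> (\forall t \near 0, 0 <= t ^+ 2 * q t) -> 0 <= q 0.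
Proof.
move=> cq H; rewrite leNgt; apply/negP => q0.
have /nbhs_ballP[e /= e0 He] : \forall t \near 0, q t < 0 /\ 0 <= t ^+ 2 * q t
    by apply: filterI H; exact: cq _ (lt_nbhsl q0).
have [] := He (e / 2); first by rewrite /ball /= sub0r normrN gtr0_norm; lra.
by rewrite /= pmulr_rge0 ?exprn_gt0 ?divr_gt0// => qe /(lt_le_trans qe); rewrite ltxx.
Qed.

Definition quartic {R : realType} (a c z : R) : R :=
  z ^+ 2 * (z - a) ^+ 2 + c * z ^+ 2.

Lemma quartic_local_min_crit {R : realType} {a c y : R} : y != 0 ->
  (\forall t \near 0, quartic a c y <= quartic a c (y + t)) ->
  c = - ((2 * y - a) * (y - a)).
Proof.
move=> y0 ymin.
(* [t * p.[t]] is the increment of the quartic from [y] to [y + t]. *)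
pose A := 2 * y * ((2 * y - a) * (y - a) + c).
pose p := A%:P + ((2 * y - a) ^+ 2 + 2 * y * (y - a) + c) *: 'X
          + (2 * (2 * y - a)) *: 'X^2 + 'X^3.
have : p.[0] = 0.
  apply: near0_mul_ge0_eq0; first exact: continuous_horner.
  apply: filterS ymin => t; rewrite -subr_ge0; congr (0 <= _).
  by rewrite /p /A /quartic !(hornerD, hornerC, hornerZ, hornerX, hornerXn); ring.
rewrite /p !(hornerD, hornerC, hornerZ, hornerX, hornerXn) !expr0n /=.
(* Only [A], the derivative of the quartic at [y], is left; its factor [2 * y] is nonzero. *)
move/eqP; rewrite !mulr0 !addr0 /A !mulf_eq0 (negPf y0) pnatr_eq0 /= => /eqP; lra.
Qed.

Lemma quartic_local_min_bound {R : realType} {a c y : R} : y != 0 ->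
  (\forall t \near 0, quartic a c y <= quartic a c (y + t)) ->
  4 * c <= y ^+ 2.
Proof.
move=> y0 /(quartic_local_min_crit y0) ->.
(* For this [c], [y ^+ 2 - 4 * c] is exactly [(2 * a - 3 * y) ^+ 2]. *)
by have := sqr_ge0 (2 * a - 3 * y); nra.
Qed.

Lemma quartic_local_min_eq {R : realType} {a y : R} : y != 0 ->
  (\forall t \near 0, quartic a 0 y <= quartic a 0 (y + t)) -> y = a.
Proof.
move=> y0 ymin; have := quartic_local_min_crit y0 ymin.
move=> /esym/eqP; rewrite oppr_eq0 mulf_eq0 !subr_eq0 => /orP[/eqP ay|/eqP//].
(* With [a = 2 y], the increment is [t ^+ 2 * p.[t]]. *)
pose p : {poly R} := (- (2 * y ^+ 2))%:P + 'X^2.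
suff : 0 <= p.[0].
  rewrite /p !(hornerD, hornerC, hornerZ, hornerX, hornerXn) expr0n /= addr0 oppr_ge0.
  by have : 0 < y ^+ 2 by [rewrite exprn_even_gt0]; lra.
apply: near0_mul_sqr_ge0; first exact: continuous_horner.
apply: filterS ymin => t; rewrite -subr_ge0; congr (0 <= _).
by rewrite /p /quartic -ay !(hornerD, hornerC, hornerZ, hornerX, hornerXn); ring.
Qed.

(** Trades the ordered pairs for full sums, from which a single coordinate is easy to split off. The
    expanded square is cut into [i < j], [i = j] and [j < i]; the outer parts agree by symmetry. *)
Lemma sum_lt_pairs {R : comNzRingType} {n : nat} (u : 'I_n -> R) :
  2 * (\sum_(i < n) \sum_(j < n | (i < j)%N) u i * u j)
  = (\sum_(i < n) u i) ^+ 2 - \sum_(i < n) u i ^+ 2.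
Proof.
have -> : (\sum_(i < n) u i) ^+ 2 =
   \sum_(i < n) (\sum_(j < n | (i < j)%N) u i * u j
     + u i ^+ 2 + \sum_(j < n | (j < i)%N) u i * u j).
  rewrite expr2 mulr_suml; apply: eq_bigr => i _.
  rewrite mulr_sumr (bigID (fun j : 'I_n => (i < j)%N)) /= -addrA; congr (_ + _).
  rewrite (bigD1 i) ?ltnn//= -expr2; congr (_ + _).
  by apply: eq_bigl => j; rewrite -leqNgt -val_eqE /= ltn_neqAle andbC.
rewrite !big_split /= [X in _ + _ + X](exchange_big_dep predT)//=.
under [X in _ + _ + X]eq_bigr do under eq_bigr do rewrite mulrC.
by ring.
Qed.

Definition quartic_sum {R : realType} {n : nat} (a : 'I_n -> R) (x : 'rV[R]_n) :=
  \sum_(i < n) x 0 i ^+ 2 * (x 0 i - a i) ^+ 2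
  + \sum_(i < n) \sum_(j < n | (i < j)%N) x 0 i ^+ 2 * x 0 j ^+ 2.

Definition off_sqr {R : realType} {n : nat} (x : 'rV[R]_n) (i : 'I_n) : R :=
  \sum_(j < n | j != i) x 0 j ^+ 2.

Lemma quartic_sum_ge0 {R : realType} {n : nat} (a : 'I_n -> R) x :
  0 <= quartic_sum a x.
Proof.
rewrite addr_ge0// !sumr_ge0// => i _; first by rewrite mulr_ge0 ?sqr_ge0.
by rewrite sumr_ge0// => j _; rewrite mulr_ge0 ?sqr_ge0.
Qed.

Lemma quartic_sum0 {R : realType} {n : nat} (a : 'I_n -> R) :
  quartic_sum a 0 = 0.
Proof.
rewrite /quartic_sum !big1 ?addr0// => i _.
  by rewrite big1// => j _; rewrite mxE expr0n mul0r.
by rewrite mxE expr0n mul0r.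
Qed.

(** The [quartic] term collects everything that involves coordinate [i], so the difference depends
    only on the other coordinates. *)
Lemma quartic_sum_line {R : realType} {n : nat} (a : 'I_n -> R) {x y : 'rV[R]_n} {i} :
  (forall j, j != i -> y 0 j = x 0 j) ->
  quartic_sum a y - quartic (a i) (off_sqr x i) (y 0 i)
  = quartic_sum a x - quartic (a i) (off_sqr x i) (x 0 i).
Proof.
(* Doubling makes [sum_lt_pairs] applicable. *)
move=> xy; apply: (mulfI (x := 2)); first by rewrite pnatr_eq0.
rewrite /quartic_sum !(mulrBr, mulrDr) !sum_lt_pairs.
have D (h : 'I_n -> R) : \sum_j h j = h i + \sum_(j | j != i) h j by exact: bigD1.
have E (h : 'I_n -> R -> R) :
    \sum_(j < n | j != i) h j (y 0 j) = \sum_(j < n | j != i) h j (x 0 j).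
  by apply: eq_bigr => j /xy ->.
rewrite !D (E (fun j z => z ^+ 2 * (z - a j) ^+ 2)) (E (fun=> fun z => z ^+ 2)).
rewrite (E (fun=> fun z => (z ^+ 2) ^+ 2)) -/(off_sqr x i) /quartic.
by ring.
Qed.

Lemma local_minimizer_line {R : realType} {n : nat} {a : 'I_n -> R} {x} i :
  local_minimizer (quartic_sum a) x ->
  \forall t \near 0, quartic (a i) (off_sqr x i) (x 0 i)
                     <= quartic (a i) (off_sqr x i) (x 0 i + t).
Proof.
move=> xmin.
have cx : x + t *: delta_mx 0 i @[t --> (0 : R)] --> x.
  have : x + t *: delta_mx 0 i @[t --> (0 : R)] --> x + 0 *: delta_mx 0 i.
    by apply: cvgD; [exact: cvg_cst|apply: cvgZr_tmp; exact: cvg_id].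
  by rewrite scale0r addr0.
have : \forall t \near (0 : R),
    quartic_sum a x <= quartic_sum a (x + t *: delta_mx 0 i) by exact: cx _ xmin.
apply: filterS => t.
have : forall j, j != i -> (x + t *: delta_mx 0 i) 0 j = x 0 j.
  by move=> j ji; rewrite !mxE (negPf ji) andbF mulr0 addr0.
move=> /(quartic_sum_line a); rewrite !mxE !eqxx mulr1; lra.
Qed.

Lemma local_minimizer_value {R : realType} {n : nat} {a : 'I_n -> R} {x} :
  local_minimizer (quartic_sum a) x -> quartic_sum a x = 0.
Proof.
move=> xmin.
have [/existsP[i xi0]|/existsPn x0] := boolP [exists i, x 0 i != 0]; last first.
  suff -> : x = 0 by exact: quartic_sum0.
  by apply/rowP => i; rewrite mxE; apply/eqP; rewrite -[_ == _]negbK.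
have off_bound j : x 0 j != 0 -> 4 * off_sqr x j <= x 0 j ^+ 2.
  by move=> xj0; apply: quartic_local_min_bound (local_minimizer_line j xmin).
have xj0 j : j != i -> x 0 j = 0.
  move=> ji; apply: contrapT => /eqP xj0.
  have sqr_le_off k l : l != k -> x 0 l ^+ 2 <= off_sqr x k.
    by move=> lk; rewrite /off_sqr (bigD1 l)//= lerDl sumr_ge0// => m _; exact: sqr_ge0.
  have := off_bound i xi0; have := off_bound j xj0.
  have := sqr_le_off i j ji; have := sqr_le_off j i; rewrite eq_sym => /(_ ji).
  have : 0 < x 0 i ^+ 2 by rewrite exprn_even_gt0.
  by lra.
have off0 : off_sqr x i = 0 by rewrite /off_sqr big1// => j /xj0 ->; rewrite expr0n.
have xi : x 0 i = a i.
  apply: quartic_local_min_eq => //.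
  by have := local_minimizer_line i xmin; rewrite off0.
(* The origin differs from [x] at most in coordinate [i], and [quartic (a i) 0] vanishes at both 0
   and [a i], so both points have the same value. *)
have : forall j, j != i -> (0 : 'rV[R]_n) 0 j = x 0 j.
  by move=> j /xj0 ->; rewrite mxE.
move=> /(quartic_sum_line a).
by rewrite quartic_sum0 off0 mxE xi /quartic; lra.
Qed.

Theorem theorem4p1 (R : realType) (n : nat) (a : 'I_n -> R)
    (ha : forall i : 'I_n, a i != 0) :
  let f := fun x : 'rV[R]_n =>
    \sum_(i < n) x 0 i ^+ 2 * (x 0 i - a i) ^+ 2
    + \sum_(i < n) \sum_(j < n | (i < j)%N) x 0 i ^+ 2 * x 0 j ^+ 2 in
  ~ (exists x : 'rV[R]_n, spurious_minimizer f x).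
Proof.
move=> f [x [xmin]]; apply => y; change (quartic_sum a x <= quartic_sum a y).
by rewrite (local_minimizer_value xmin) quartic_sum_ge0.
Qed.
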